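(* Let $k$ be a positive integer and let $D$ be a digraph of order $n \geq 3k$. If $\delta^{0}(D) \geq \lceil (n+k)/2 \rceil$, then $D$ is unpaired many-to-many $k$-coverable. Moreover, the bound for $\delta^{0}(D)$ is sharp, in the following sense: for every $k \geq 1$ and every $n \geq 3k+1$ there exists a digraph $D$ on $n$ vertices with $\delta^{0}(D) = \lceil (n+k)/2 \rceil - 1$ which is not unpaired many-to-many $k$-coverable.
   Context: All digraphs $D=(V(D),A(D))$ are finite, with no parallel arcs and no loops (pairs of oppositely directed arcs are allowed). The order of $D$ is $|V(D)|$. A path always means a directed path; an $x$-$y$ path is a path from $x$ to $y$. The minimum semi-degree $\delta^{0}(D)$ is the minimum, over all vertices $v$ of $D$, of the out-degrees $d^{+}_D(v)$ and in-degrees $d^{-}_D(v)$. Let $S=\{s_1,\dots,s_k\}$ (source set) and $T=\{t_1,\dots,t_k\}$ (sink set) be two disjoint $k$-element subsets of $V(D)$. An unpaired many-to-many $k$-DDPC ($k$-disjoint directed path cover) for $S$ and $T$ is a set of $k$ pairwise vertex-disjoint paths $\{P_1,\dots,P_k\}$ of $D$ with $\bigcup_{i=1}^{k} V(P_i)=V(D)$ such that, for some permutation $\sigma$ of $\{1,\dots,k\}$, $P_i$ is an $s_i$-$t_{\sigma(i)}$ path for each $i$. A digraph $D$ of order $n\geq 2k$ is unpaired many-to-many $k$-coverable if it has an unpaired many-to-many $k$-DDPC for every pair of disjoint source set $S=\{s_1,\dots,s_k\}$ and sink set $T=\{t_1,\dots,t_k\}$. *)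

(* Defs.v *)
From HB Require Import structures.
From mathcomp Require Import all_boot all_fingroup.

Set Implicit Arguments.
Unset Strict Implicit.
Unset Printing Implicit Defensive.

(* A relation [rel V] already excludes parallel arcs and allows pairs of
   opposite arcs. *)
Record digraph := Digraph {
  vertex :> finType;
  is_arc : rel vertex;
  is_arc_irr : irreflexive is_arc
}.

Section Digraph.

Variable D : digraph.
Implicit Types (v x y : D) (p : seq D).

Definition dorder := #|D|.

Definition outdeg v := #|[set x : D | is_arc v x]|.
Definition indeg v := #|[set x : D | is_arc x v]|.

(* Every degree is at most [dorder], so the default value [dorder] matters only
   for the digraph without vertices. *)
Definition min_semidegree :=
  \big[minn/dorder]_(v : D) minn (outdeg v) (indeg v).

(* A path is given by the sequence of all its vertices, both ends included. *)
Definition dipath x y p :=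
  exists q : seq D,
    [/\ p = x :: q, path (@is_arc D) x q, last x q = y & uniq p].

Variable k : nat.

Definition unpaired_DDPC (s t : 'I_k -> D) (P : 'I_k -> seq D) :=
  [/\ exists sigma : {perm 'I_k}, forall i, dipath (s i) (t (sigma i)) (P i),
      forall i j, i != j -> [disjoint P i & P j]
    & forall v, exists i, v \in P i].

(* Injectivity makes S = {s_1, ..., s_k} and T = {t_1, ..., t_k} sets of exactly
   k elements. *)
Definition unpaired_coverable :=
  2 * k <= dorder /\
  forall s t : 'I_k -> D,
    injective s -> injective t -> (forall i j, s i != t j) ->
    exists P : 'I_k -> seq D, unpaired_DDPC s t P.

End Digraph.

(* Main.v *)
Require Import Defs.
From mathcomp Require Import all_boot all_fingroup.
From mathcomp Require Import path zify.

Set Implicit Arguments.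
Unset Strict Implicit.
Unset Printing Implicit Defensive.

(** Covering by paths reduces to finding a Hamiltonian cycle.  Glue each source
    [s i] and the sink [t i] into one vertex that has the out-arcs of [s i] and
    the in-arcs of [t i].  The glued digraph has n' = n - k vertices.  A vertex
    loses at most k out-neighbours, because the sources can no longer be
    entered (and a glued vertex, whose arc from [s i] to [t i] would be a loop,
    starts at one of these k sources), and likewise at most k in-neighbours; so all semidegrees are still
    at least (n + k)/2 - k = n'/2.  By the theorem of Ghouila-Houri the glued
    digraph has a Hamiltonian cycle ([Hamiltonian_cycle]), and ungluing cuts
    that cycle, at the glued vertices, into k paths from sources to sinks
    ([DDPC_of_Hamiltonian_cycle]).

    For the theorem of Ghouila-Houri, let c be a longest cycle of a digraph of
    order n with semidegrees at least n/2, and suppose that c is not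
    Hamiltonian.  Let P be a longest path outside c, with r vertices.  The
    in-neighbours of its first vertex and the out-neighbours of its last vertex
    lie on c or P, hence at least n/2 - (r - 1) of each kind, the sets A and B,
    lie on c; as c has more than n/2 vertices, A and B are not empty.
    Whenever going along c from some a in A one reaches some b in B, at least r
    vertices lie strictly between, as otherwise the detour a P b would give a
    longer cycle.  Choose a and b with no vertex of A or B between them: these
    r vertices are missed by both sets, and on the rest of c no vertex of A
    is followed by one of B.  So |A| + |B| <= |c| - r + 1, while
    |A| + |B| >= n - 2 (r - 1) and |c| + r <= n, a contradiction.

    For sharpness, let d = ceil((n + k)/2) - 1, and let all pairs of vertices be
    adjacent both ways, except inside an independent set I of n - d vertices.
    Since n >= 3 k + 1, all sources and sinks fit outside I.  Then each path of
    a cover has fewer vertices in I than outside it, so that n - d + k <= d,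
    which is false ([DDPC_independent], [extremal_not_coverable]). *)

(** * Sequences, paths and cycles *)

Section Lists.

Variable T : eqType.
Implicit Types (A B : pred T) (s : seq T).

Lemma cycle_catC (e : rel T) s1 s2 : cycle e (s1 ++ s2) = cycle e (s2 ++ s1).
Proof. by rewrite -(rot_cycle (size s1)) rot_size_cat. Qed.

Lemma split_first A s :
  has A s -> exists s1 x s2, [/\ s = s1 ++ x :: s2, A x & ~~ has A s1].
Proof.
elim: s => //= y s IHs; case: (boolP (A y)) => [Ay _|nAy /= /IHs].
  by exists [::], y, s.
by move=> [s1 [x [s2 [-> Ax nA]]]]; exists (y :: s1), x, s2; rewrite /= negb_or nAy.
Qed.

Lemma split_last A s :
  has A s -> exists s1 x s2, [/\ s = s1 ++ x :: s2, A x & ~~ has A s2].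
Proof.
rewrite -has_rev => /split_first[s1 [x [s2 [Es Ax nA]]]].
exists (rev s2), x, (rev s1); rewrite has_rev; split=> //.
by rewrite -[s]revK Es rev_cat rev_cons cat_rcons.
Qed.

(** Unlike [pathP], this gives access to the two parts of the sequence around a
    pair of consecutive entries, which is what rotating a cycle at that pair
    needs. *)
Lemma path_infix (r : rel T) x s :
  (forall s1 u v s2, x :: s = s1 ++ u :: v :: s2 -> r u v) -> path r x s.
Proof.
elim: s x => //= y s IHs x r_xs; rewrite (r_xs [::] x y s) //=.
by apply: IHs => s1 u v s2 Es; apply: (r_xs (x :: s1) u v s2); rewrite Es.
Qed.

(** Each of the [size s] consecutive pairs (u, v) contributes at most 1 to the
    number of u in [A] plus the number of v in [B]; the first entry, as a member
    of [B], and the last one, as a member of [A], account for the other 2. *)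
Lemma count_no_succ A B x s : path (fun u v => ~~ (A u && B v)) x s ->
  count A (x :: s) + count B (x :: s) <= (size s).+2.
Proof.
suff cnt : path (fun u v => ~~ (A u && B v)) x s ->
    count A (x :: s) + count B s <= (size s).+1.
  by move/cnt; rewrite /=; case: (B x) => /=; lia.
elim: s x => [|y s IHs] x /=; first by case: (A x).
by case/andP=> AB /IHs /=; move: AB; case: (A x); case: (B y) => //=; lia.
Qed.

(** Rotate the cycle so that it ends in [A], and stop at its first entry in [B].
    The entries before may still meet [A]; moving everything up to the last
    such entry to the end of the cycle leaves a block [x] that meets neither
    set. *)
Lemma cyclic_gap (e : rel T) A B s : has A s -> has B s -> cycle e s ->
  exists x b y, [/\ perm_eq (x ++ b :: y) s, cycle e (x ++ b :: y),
    A (last b y), B b & ~~ has A x && ~~ has B x].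
Proof.
move=> /split_last[s1 [a [s2 [-> Aa _]]]] hasB.
rewrite -cat_rcons cycle_catC => cyc_s.
have /split_first[v [b [y [Es Bb nBv]]]]: has B (s2 ++ rcons s1 a).
  by move: hasB; rewrite -cat_rcons !has_cat orbC.
have Al : A (last b y).
  by move/(congr1 (last a)): Es; rewrite !last_cat last_rcons /= => <-.
rewrite Es in cyc_s.
have perm_s x : perm_eq x (rcons s1 a ++ s2) = perm_eq x (v ++ b :: y).
  by rewrite -Es perm_sym perm_catC perm_sym.
case: (boolP (has A v)) => [|nAv].
  2: by exists v, b, y; rewrite perm_s nAv nBv.
move=> /split_last[v1 [a' [x [Ev Aa' nAx]]]]; subst v.
exists x, b, (y ++ rcons v1 a').
have Ev : (v1 ++ a' :: x) ++ b :: y = rcons v1 a' ++ (x ++ b :: y).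
  by rewrite catA cat_rcons.
rewrite last_cat last_rcons -cat_cons catA; split=> //.
- by rewrite perm_s Ev perm_catC.
- by rewrite cycle_catC -Ev.
by move: nBv; rewrite nAx has_cat /= !negb_or => /and3P[].
Qed.

Lemma flatten_uniq_eq (ss : seq (seq T)) p q x :
  uniq (flatten ss) -> p \in ss -> q \in ss -> x \in p -> x \in q -> p = q.
Proof.
elim: ss => //= r ss IHss; rewrite cat_uniq => /and3P[_ /hasPn r_ss uniq_ss].
have out o : o \in ss -> x \in o -> x \notin r.
  by move=> o_ss x_o; apply: r_ss; apply/flattenP; exists o.
rewrite !inE => /predU1P[->|p_ss] /predU1P[->|q_ss] // x_p x_q.
- by have:= out q q_ss x_q; rewrite x_p.
- by have:= out p p_ss x_p; rewrite x_q.
- exact: IHss.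
Qed.

Lemma flatten_uniq (ss : seq (seq T)) p :
  uniq (flatten ss) -> p \in ss -> uniq p.
Proof.
elim: ss => //= r ss IHss; rewrite cat_uniq inE => /and3P[uniq_r _ uniq_ss].
by case/predU1P=> [->|] //; apply: IHss.
Qed.

End Lists.

(** * Longest paths *)

Section FiniteRelation.

Variables (T : finType) (e : rel T).
Implicit Types (A : pred T) (s c p : seq T).

Lemma longest_seq (P : pred (seq T)) s0 :
    P s0 -> (forall s, P s -> uniq s) ->
  exists2 s, P s & forall s', P s' -> size s' <= size s.
Proof.
move=> Ps0 Puniq; pose Q n := [exists t : n.-tuple T, P t].
have PQ s : P s -> Q (size s) by move=> Ps; apply/existsP; exists (in_tuple s).
have exQ : exists n, Q n by exists (size s0); apply: PQ.
have Qmax n : Q n -> n <= #|T|.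
  by case/existsP=> t /Puniq /card_uniqP; rewrite size_tuple => <-; apply: max_card.
case: (ex_maxnP exQ Qmax) => m /existsP[t Pt] max_m.
by exists t => // s' /PQ /max_m; rewrite size_tuple.
Qed.

Lemma card_leq_count A s :
  (forall x, A x -> x \in s) -> #|[set x | A x]| <= count A s.
Proof.
move=> As; rewrite -size_filter; apply: leq_trans (card_size _).
by apply/subset_leq_card/subsetP=> x; rewrite inE mem_filter => Ax; rewrite Ax As.
Qed.

(** A longest path outside [c] cannot be extended at either end, which confines
    the in-neighbours of its first vertex and the out-neighbours of its last
    one. *)
Lemma longest_path_outside c x : uniq c -> x \notin c ->
  exists (h : T) (q : seq T), [/\ uniq (c ++ h :: q), path e h q,
    forall y, e y h -> y \in c ++ h :: q
    & forall y, e (last h q) y -> y \in c ++ h :: q].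
Proof.
move=> uniq_c xNc; pose P p := sorted e p && uniq (c ++ p).
have [||p] := @longest_seq P [:: x].
- by rewrite /P /= cat_uniq uniq_c /= orbF xNc.
- by move=> s /andP[_]; rewrite cat_uniq => /and3P[].
case/andP=> e_p uniq_cp max_p.
case: p e_p uniq_cp max_p => [|h q] /= e_p uniq_cp max_p.
  have:= max_p [:: x]; rewrite /P /= cat_uniq uniq_c /= orbF xNc.
  by move/(_ isT).
exists h, q; split=> // y e_y; apply: contraT => yN.
  have:= max_p [:: y, h & q]; rewrite /P /= e_y e_p -(cat1s y) uniq_catCA /= yN uniq_cp.
  by move/(_ isT); rewrite ltnn.
have:= max_p (h :: rcons q y).
rewrite /P /= rcons_path e_p e_y -rcons_cons -rcons_cat rcons_uniq yN uniq_cp.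
by move/(_ isT); rewrite size_rcons ltnn.
Qed.

End FiniteRelation.

(** * The theorem of Ghouila-Houri for semidegrees *)

Section GhouilaHouri.

Variables (T : finType) (e : rel T).
Hypothesis e_irr : irreflexive e.
Hypothesis outdeg_ge : forall x, #|T| <= 2 * #|[set y | e x y]|.
Hypothesis indeg_ge : forall x, #|T| <= 2 * #|[set y | e y x]|.

(** All in-neighbours of the first vertex [h] of a longest path lie on the path;
    closing the path up at the last of them gives a cycle that contains [h] and
    all its in-neighbours. *)
Lemma long_cycle (x : T) : exists c : seq T,
  [/\ uniq c, cycle e c & #|T| + 2 <= 2 * size c].
Proof.
have [h [q [/= uniq_p e_p in_h _]]] := @longest_path_outside T e [::] x isT isT.
have in_q y : e y h -> y \in q.
  move=> eyh; have:= in_h y eyh; rewrite inE => /predU1P[yh|//].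
  by rewrite yh e_irr in eyh.
have has_q : has (e^~ h) q.
  have/card_gt0P[y]: 0 < #|[set y | e y h]|.
    have T_gt0 : 0 < #|T| by apply/card_gt0P; exists x.
    by have:= indeg_ge h; lia.
  by rewrite inE => eyh; apply/hasP; exists y; rewrite ?in_q.
have [q1 [z [q2 [Eq ezh nq2]]]] := split_last has_q.
exists (h :: rcons q1 z); split.
- by move: uniq_p; rewrite -/(uniq (h :: q)) Eq -cat_rcons -cat_cons cat_uniq => /andP[].
- rewrite /= rcons_path last_rcons ezh andbT.
  by move: e_p; rewrite Eq -cat_rcons cat_path => /andP[].
have := card_leq_count in_q; rewrite Eq -cat_rcons count_cat.
move: nq2; rewrite has_count -eqn0Ngt => /eqP->.
have:= count_size (e^~ h) (rcons q1 z); have:= indeg_ge h => /=.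
by lia.
Qed.

Theorem Hamiltonian_cycle : exists c : seq T, [/\ uniq c, cycle e c & forall x, x \in c].
Proof.
pose P c := uniq c && cycle e c.
have [//||c /andP[uniq_c cyc_c] max_c] := @longest_seq T P [::].
  by move=> s /andP[].
exists c; split=> // x; apply: contraT => xNc.
have long_c : #|T| + 2 <= 2 * size c.
  have [c' [uc' cc' sc']] := long_cycle x.
  by have := max_c c'; rewrite /P uc' cc' => /(_ isT); lia.
have [h [q [uniq_cq e_q in_h out_l]]] := longest_path_outside e uniq_c xNc.
set A := e^~ h; set B := e (last h q).
have size_cq : size c + (size q).+1 <= #|T|.
  have/card_uniqP := uniq_cq; rewrite size_cat /= => <-; exact: max_card.
have cntA : #|T| <= 2 * (count A c + size q).
  apply: leq_trans (indeg_ge h) _; rewrite leq_mul2l /=.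
  apply: leq_trans (card_leq_count in_h) _.
  by rewrite count_cat /= /A e_irr leq_add2l count_size.
have cntB : #|T| <= 2 * (count B c + size q).
  apply: leq_trans (outdeg_ge (last h q)) _; rewrite leq_mul2l /=.
  apply: leq_trans (card_leq_count out_l) _.
  rewrite count_cat lastI -cats1 count_cat /= /B e_irr !addn0 leq_add2l.
  by rewrite -(size_belast h q) count_size.
(* Replacing the block [u] by the path h :: q cannot give a longer cycle. *)
have insert u b y : perm_eq (u ++ b :: y) c -> cycle e (u ++ b :: y) ->
    A (last b y) -> B b -> size q < size u.
  move=> perm_c cyc_u Al Bb.
  have := max_c (b :: y ++ h :: q); rewrite /P => /(_ _).
  have -> : uniq (b :: y ++ h :: q).
    move: uniq_cq; rewrite -(perm_uniq (perm_cat perm_c (perm_refl _))) -catA.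
    by rewrite cat_uniq => /and3P[].
  have -> : cycle e (b :: y ++ h :: q).
    rewrite /= rcons_cat cat_path /= rcons_path [e _ h]Al e_q [e _ b]Bb !andbT.
    by move: cyc_u; rewrite cycle_catC /= rcons_cat cat_path => /andP[].
  move/(_ isT); rewrite -(perm_size perm_c) /= !size_cat /=; lia.
have hasA : has A c by rewrite has_count; lia.
have hasB : has B c by rewrite has_count; lia.
have [u [b [y [perm_c cyc_u Al Bb /andP[nA nB]]]]] := cyclic_gap hasA hasB cyc_c.
have gap_u := insert u b y perm_c cyc_u Al Bb.
(* [insert] with an empty block: P fits between adjacent members of A and B. *)
have no_succ : path (fun v w => ~~ (A v && B w)) b y.
  apply: path_infix => s1 v w s2 Es; apply/negP=> /andP[Av Bw].
  rewrite Es -cat_rcons catA in perm_c cyc_u.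
  have := insert [::] w (s2 ++ u ++ rcons s1 v).
  rewrite !cat0s -cat_cons perm_catC cycle_catC !last_cat last_rcons.
  by move/(_ perm_c cyc_u Av Bw).
(* The block [u] between A and B contributes nothing to either count. *)
have cnt0 a : ~~ has a u -> count a c = count a (b :: y).
  by rewrite has_count -eqn0Ngt -(seq.permP perm_c) count_cat => /eqP->.
have cntAB : count A c + count B c <= (@size T y).+2.
  by rewrite (cnt0 _ nA) (cnt0 _ nB); apply: count_no_succ.
have size_c : @size T u + (@size T y).+1 = size c.
  by rewrite -(perm_size perm_c) size_cat.
(* |A| + |B| >= n - 2 (r - 1) against |A| + |B| <= |c| - r + 1, with
   r = size q + 1. *)
move: cntA cntB size_cq gap_u cntAB size_c; clear.
move: (count A c) (count B c) (size c) (size q) (@size T u) (@size T y) #|T|.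
by lia.
Qed.

End GhouilaHouri.

(** * Gluing sources to sinks *)

Section Merge.

Variables (D : digraph) (k : nat) (s t : 'I_k -> D).
Hypotheses (s_inj : injective s) (t_inj : injective t).
Hypothesis st_disj : forall i j, s i != t j.

Definition inner v := (v \notin codom s) && (v \notin codom t).

Lemma inner_s i : inner (s i) = false.
Proof. by rewrite /inner codom_f. Qed.

Lemma inner_t i : inner (t i) = false.
Proof. by rewrite /inner codom_f andbF. Qed.

(** [inl i] is the result of gluing [s i] to [t i].  An arc leaves a vertex of
    the glued digraph at its [tail_end] and enters it at its [head_end]. *)
Definition merged := ('I_k + {v : D | inner v})%type.

Definition tail_end (a : merged) : D :=
  match a with inl i => s i | inr v => val v end.

Definition head_end (a : merged) : D :=
  match a with inl i => t i | inr v => val v end.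

Definition merged_arc (a b : merged) :=
  (a != b) && is_arc (tail_end a) (head_end b).

Lemma tail_head_end a b :
  tail_end a = head_end b -> exists2 v, a = inr v & b = inr v.
Proof.
case: a b => [i|[v v_in]] [j|[w w_in]] /= E.
- by have:= st_disj i j; rewrite E eqxx.
- by case/negP: (negbT (inner_s i)); rewrite E.
- by case/negP: (negbT (inner_t j)); rewrite -E.
- by exists (exist _ w w_in) => //; congr inr; apply: val_inj.
Qed.

Lemma tail_end_inj : injective tail_end.
Proof.
move=> [i|[v v_in]] [j|[w w_in]] /= E.
- by rewrite (s_inj E).
- by case/negP: (negbT (inner_s i)); rewrite E.
- by case/negP: (negbT (inner_s j)); rewrite -E.
- by congr inr; apply: val_inj.
Qed.

Lemma in_tail_end v : v \notin codom t -> v \in codom tail_end.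
Proof.
move=> vNt; case: (boolP (v \in codom s)) => [/codomP[i ->]|vNs].
  exact: (codom_f tail_end (inl i)).
have v_in : inner v by rewrite /inner vNs vNt.
exact: (codom_f tail_end (inr (exist _ v v_in))).
Qed.

Lemma in_head_end v : v \notin codom s -> v \in codom head_end.
Proof.
move=> vNs; case: (boolP (v \in codom t)) => [/codomP[i ->]|vNt].
  exact: (codom_f head_end (inl i)).
have v_in : inner v by rewrite /inner vNs vNt.
exact: (codom_f head_end (inr (exist _ v v_in))).
Qed.

Lemma card_merged : #|{: merged}| + k = #|D|.
Proof.
rewrite -(card_codom tail_end_inj) -{2}(card_ord k) -(card_codom t_inj).
rewrite -(cardC (mem (codom t))) addnC; congr (_ + _); apply: eq_card => v.
rewrite !inE; apply/idP/idP => [/codomP[a ->]|/in_tail_end//].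
apply/negP=> /codomP[j E]; have [v' _ //] := @tail_head_end a (inl j) E.
Qed.

(** The out- and in-degree bounds in one statement, the latter with all arcs
    reversed.  The neighbours that are lost belong to [codom r], or are equal to
    [g a] (a loop).  These are k + 1 candidates, but either [f a] is in
    [codom r], and is not its own neighbour, or [g a] = [f a] is not
    a neighbour either. *)
Lemma degree_lost (f g : merged -> D) (r : 'I_k -> D) (a : merged)
    (N : pred D) :
  (forall v, v \notin codom r -> v \in codom g) ->
  (f a \in codom r \/ f a = g a) -> ~~ N (f a) ->
  #|[set v | N v]| <= #|[set b | (a != b) && N (g b)]| + k.
Proof.
move=> cover_g fa_lost NNfa.
pose X := [set b | (a != b) && N (g b)].
pose R := [set v in codom r].
have card_R : #|R| <= k.
  by rewrite cardsE; apply: leq_trans (card_size _) _; rewrite size_codom card_ord.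
have sub : [set v | N v] \subset g @: X :|: ((g a |: R) :\ f a).
  apply/subsetP=> v; rewrite !inE => Nv.
  have -> : v != f a by apply: contraNneq NNfa => <-.
  case: eqVneq => [|vNga] /=; first by rewrite orbT.
  case: (boolP (v \in codom r)) => [|/cover_g/codomP[b Eb]]; first by rewrite orbT.
  rewrite Eb imset_f // inE -Eb Nv andbT.
  by apply: contraNneq vNga => ->; rewrite Eb.
apply: leq_trans (subset_leq_card sub) _; apply: leq_trans (leq_card_setU _ _) _.
apply: leq_add; first exact: leq_imset_card.
rewrite -ltnS; case: fa_lost => [fa_r|fa_ga].
  have:= cardsD1 (f a) (g a |: R); rewrite !inE fa_r orbT add1n => <-.
  by rewrite cardsU1 -add1n leq_add // leq_b1.
rewrite ltnS fa_ga; apply: leq_trans card_R; apply/subset_leq_card/subsetP=> v.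
by rewrite !inE => /andP[/negPf->].
Qed.

Lemma merged_outdeg a : outdeg (tail_end a) <= #|[set b | merged_arc a b]| + k.
Proof.
apply: (@degree_lost tail_end head_end s a (is_arc (tail_end a))).
- exact: in_head_end.
- by case: a => [i|v]; [left; apply: codom_f | right].
- by rewrite is_arc_irr.
Qed.

Lemma merged_indeg a : indeg (head_end a) <= #|[set b | merged_arc b a]| + k.
Proof.
under eq_finset => b do rewrite /merged_arc eq_sym.
apply: (@degree_lost head_end tail_end t a (@is_arc D ^~ (head_end a))).
- exact: in_tail_end.
- by case: a => [i|v]; [left; apply: codom_f | right].
- by rewrite is_arc_irr.
Qed.

(** Cuts the walk that follows [x] and [p] at each glued vertex: a path that
    enters [inl i] ends in [t i], and the next one starts in [s i].  The path
    begun after the last glued vertex is dropped, which is harmless for a closed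
    walk whose last vertex is the glued one that it starts from. *)
Fixpoint segments (x : D) (p : seq D) (w : seq merged) : seq (D * seq D) :=
  match w with
  | [::] => [::]
  | inl i :: w' => (x, rcons p (t i)) :: segments (s i) [::] w'
  | inr v :: w' => segments x (rcons p (val v)) w'
  end.

Definition unmerge (a : merged) : seq D :=
  match a with inl i => [:: t i; s i] | inr v => [:: val v] end.

(** The leftover start [s i] of the dropped path is put back on the left-hand
    side; the right-hand side is the whole walk, unglued. *)
Lemma segments_flatten x p w i :
  rcons (flatten [seq pr.1 :: pr.2 | pr <- segments x p (rcons w (inl i))]) (s i)
    = x :: p ++ flatten (map unmerge (rcons w (inl i))).
Proof.
elim: w x p => [|[j|v] w IHw] x p /=.
- by rewrite cats0 -cats1 /= -cats1 -catA.
- by rewrite rcons_cat IHw cat_rcons.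
- by rewrite IHw cat_rcons.
Qed.

Lemma segments_paths a x p w : path merged_arc a w -> path (@is_arc D) x p ->
    last x p = tail_end a -> x \in codom s ->
  forall pr, pr \in segments x p w ->
  [/\ path (@is_arc D) pr.1 pr.2, pr.1 \in codom s & last pr.1 pr.2 \in codom t].
Proof.
elim: w a x p => [|b w IHw] a x p //= /andP[/andP[_ ab] e_w] e_p Ep xs pr.
case: b ab e_w => [j|v] /= ab e_w.
  rewrite inE => /predU1P[->|/IHw].
    by rewrite /= rcons_path e_p Ep last_rcons xs codom_f.
  by apply; [exact: e_w | | | exact: codom_f].
by apply: (IHw (inr v)) => //; rewrite ?last_rcons // rcons_path e_p Ep.
Qed.

Lemma segments_sources x p w i y :
    y = x \/ (exists2 j, inl j \in w & y = s j) ->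
  y \in [seq pr.1 | pr <- segments x p (rcons w (inl i))].
Proof.
elim: w x p y => [|[j|v] w IHw] x p y /=.
- by case=> [->|[]//]; rewrite mem_head.
- case=> [->|[j' j'_w ->]]; first by rewrite mem_head.
  rewrite inE; apply/orP; right; apply: IHw.
  by move: j'_w; rewrite inE => /predU1P[[->]|]; [left | right; exists j'].
- case=> [->|[j j_w ->]]; apply: IHw; [by left | by right; exists j].
Qed.

(** Each source belongs to a single path of the family, as do the ends of these
    paths, so both the indexing of the family by the sources and the map from
    sources to sinks are injective. *)
Lemma DDPC_of_family (pp : seq (D * seq D)) :
    uniq (flatten [seq pr.1 :: pr.2 | pr <- pp]) ->
    (forall v, v \in flatten [seq pr.1 :: pr.2 | pr <- pp]) ->
    (forall i, exists2 pr, pr \in pp & pr.1 = s i) ->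
    (forall pr, pr \in pp ->
      [/\ path (@is_arc D) pr.1 pr.2, pr.1 \in codom s & last pr.1 pr.2 \in codom t]) ->
  exists P, unpaired_DDPC s t P.
Proof.
move=> uniq_pp cover_pp /(fin_all_exists2 )[pr pr_pp pr_s] paths_pp.
have same i q x : q \in pp -> x \in (pr i).1 :: (pr i).2 -> x \in q.1 :: q.2 -> pr i = q.
  move=> q_pp x_i x_q.
  have:= flatten_uniq_eq uniq_pp (map_f _ (pr_pp i)) (map_f _ q_pp) x_i x_q.
  by case: (pr i) q {q_pp x_i x_q} => [? ?] [? ?] [-> ->].
have same_ij i j x : x \in (pr i).1 :: (pr i).2 -> x \in (pr j).1 :: (pr j).2 -> i = j.
  by move=> x_i x_j; apply: s_inj; rewrite -!pr_s (same i (pr j) x).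
have /fin_all_exists[sigma sigmaE] i : exists j, last (pr i).1 (pr i).2 = t j.
  by have [_ _ /codomP] := paths_pp _ (pr_pp i).
have sigma_inj : injective sigma.
  move=> i j Eij; apply: (@same_ij i j (last (pr i).1 (pr i).2)); first exact: mem_last.
  by rewrite sigmaE Eij -sigmaE mem_last.
exists (fun i => (pr i).1 :: (pr i).2); split.
- exists (perm sigma_inj) => i; exists (pr i).2.
  have [e_i _ _] := paths_pp _ (pr_pp i).
  rewrite permE -sigmaE -pr_s; split=> //.
  by apply: (flatten_uniq uniq_pp); apply/mapP; exists (pr i).
- move=> i j; apply: contraNT => /pred0Pn[x /andP[x_i x_j]].
  by apply/eqP; apply: same_ij x_i x_j.
- move=> v; have /flatten_mapP[q q_pp v_q] := cover_pp v.
  have [_ /codomP[i qs] _] := paths_pp _ q_pp; exists i.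
  by rewrite (same i q q.1) // ?qs -?pr_s ?mem_head // qs -pr_s mem_head.
Qed.

(** The vertices of [D] are covered by (n - k) + k entries, hence each is listed
    once. *)
Lemma unmerge_Hamiltonian c :
  uniq c -> (forall a, a \in c) -> uniq (flatten (map unmerge c)) /\
  forall v, v \in flatten (map unmerge c).
Proof.
move=> uniq_c all_c.
have all_v v : v \in flatten (map unmerge c).
  apply/flatten_mapP; case: (boolP (inner v)) => [v_in|].
    by exists (inr (exist _ v v_in)); rewrite // mem_head.
  rewrite negb_and !negbK => /orP[] /codomP[i ->].
    by exists (inl i); rewrite // inE mem_head orbT.
  by exists (inl i); rewrite // mem_head.
split=> //; apply: (@leq_size_uniq _ (enum D)); rewrite ?enum_uniq //.
rewrite -cardE -card_merged size_flatten /shape -map_comp sumnE big_map.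
have perm_c : perm_eq c (enum {: merged}).
  by apply: uniq_perm; rewrite ?enum_uniq // => a; rewrite all_c mem_enum.
rewrite (perm_big _ perm_c) big_enum big_sumType /= !sum_nat_const !card_sum card_ord.
by rewrite muln1 muln2 -addnn addnAC.
Qed.

Lemma DDPC_of_Hamiltonian_cycle c : 0 < k ->
  uniq c -> cycle merged_arc c -> (forall a, a \in c) ->
  exists P, unpaired_DDPC s t P.
Proof.
move=> k_gt0 uniq_c cyc_c all_c; pose i0 := Ordinal k_gt0.
have [n w Ec] := rot_to (all_c (inl i0)).
have uniq_w : uniq (inl i0 :: w) by rewrite -Ec rot_uniq.
have all_w a : a \in inl i0 :: w by rewrite -Ec mem_rot.
have e_w : path merged_arc (inl i0) (rcons w (inl i0)).
  by move: cyc_c; rewrite -(rot_cycle n) Ec.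
have [uniq_v all_v] := unmerge_Hamiltonian uniq_w all_w.
pose pp := segments (s i0) [::] (rcons w (inl i0)).
have perm_pp : perm_eq (flatten [seq pr.1 :: pr.2 | pr <- pp])
    (flatten (map unmerge (inl i0 :: w))).
  rewrite -(perm_cons (s i0)) -perm_rcons segments_flatten perm_cons.
  rewrite cat0s map_rcons -cats1 flatten_cat perm_catC; exact: perm_refl.
apply: (@DDPC_of_family pp).
- by rewrite (perm_uniq perm_pp).
- by move=> v; rewrite (perm_mem perm_pp).
- move=> i; have /mapP[pr pr_pp Epr] : s i \in [seq pr.1 | pr <- pp].
    apply: segments_sources; have:= all_w (inl i).
    by rewrite inE => /predU1P[[->]|]; [left | right; exists i].
  by exists pr.
- by apply: segments_paths e_w _ _ _; rewrite ?codom_f.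
Qed.

Theorem coverable_of_semidegree : 0 < k ->
    (forall v : D, #|D| + k <= 2 * outdeg v) ->
    (forall v : D, #|D| + k <= 2 * indeg v) ->
  exists P, unpaired_DDPC s t P.
Proof.
move=> k_gt0 out_ge in_ge.
have half_le m deg' deg : m + k = #|D| -> deg <= deg' + k -> #|D| + k <= 2 * deg ->
  m <= 2 * deg' by lia.
have [|a|a|c [uniq_c cyc_c all_c]] := @Hamiltonian_cycle merged merged_arc.
- by move=> a; rewrite /merged_arc eqxx.
- exact: half_le card_merged (merged_outdeg a) (out_ge _).
- exact: half_le card_merged (merged_indeg a) (in_ge _).
exact: DDPC_of_Hamiltonian_cycle cyc_c all_c.
Qed.

End Merge.


(** * Sharpness *)

Section IndependentBound.

Variables (D : digraph) (I : pred D).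
Hypothesis I_indep : forall u v, I u -> I v -> ~~ is_arc u v.

(** No two consecutive vertices are in [I]. *)
Lemma path_independent x q : path (@is_arc D) x q ->
  count I (x :: q) + 1 <= count (predC I) (x :: q) + I x + I (last x q).
Proof.
elim: q x => [|y q IHq] x /=; first by case: (I x).
case/andP=> xy /IHq /=.
have: ~~ (I x && I y) by apply/negP=> /andP[/I_indep Ix /Ix]; rewrite xy.
by case: (I x); case: (I y) => //= _; lia.
Qed.

Lemma DDPC_count k (s t : 'I_k -> D) P (A : pred D) :
  unpaired_DDPC s t P -> \sum_i count A (P i) = #|A|.
Proof.
case=> [[sigma paths]] disj cover.
have uniqP i : uniq (P i) by have [q []] := paths i.
rewrite -sum1_card (partition_big (fun v => xchoose (cover v)) predT) //=.
apply: eq_bigr => i _; rewrite -size_filter sum1_card.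
have/card_uniqP <- : uniq [seq v <- P i | A v] by rewrite filter_uniq.
apply: eq_card => v; rewrite mem_filter [RHS]inE /=; congr (_ && _).
have v_c := xchooseP (cover v).
apply/idP/eqP => [v_i|<- //]; apply/eqP; apply: contraLR v_i => /disj dij.
by rewrite (disjointFr dij v_c).
Qed.

Lemma DDPC_independent k (s t : 'I_k -> D) P :
  (forall i, ~~ I (s i)) -> (forall i, ~~ I (t i)) -> unpaired_DDPC s t P ->
  #|I| + k <= #|predC I|.
Proof.
move=> Ns Nt DP; rewrite -!(DDPC_count _ DP) -[X in _ + X]card_ord -sum1_card.
rewrite -big_split /=; apply: leq_sum => i _.
have [[sigma paths] _ _] := DP; have [q [-> e_q Eq _]] := paths i.
have:= path_independent e_q; rewrite Eq (negPf (Ns i)) (negPf (Nt _)).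
by rewrite !addn0.
Qed.

End IndependentBound.

Section Extremal.

Variables n d : nat.

Definition extremal_arc (x y : 'I_n) := (x != y) && ((x < d) || (y < d)).

Lemma extremal_arc_irr : irreflexive extremal_arc.
Proof. by move=> x; rewrite /extremal_arc eqxx. Qed.

(** The complete digraph on n vertices without the arcs inside the set of the
    n - d vertices x with d <= x. *)
Definition extremal := Digraph extremal_arc_irr.

Lemma extremal_arc_sym : symmetric extremal_arc.
Proof. by move=> x y; rewrite /extremal_arc eq_sym orbC. Qed.

Lemma card_lt : d <= n -> #|[pred x : 'I_n | x < d]| = d.
Proof.
move=> d_n; have wd_inj : injective (widen_ord d_n) by move=> x y [] /val_inj.
rewrite -[RHS]card_ord -(card_imset predT wd_inj).
apply: eq_card => x; rewrite inE; apply/idP/imsetP => [x_d|[y _ ->]].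
  2: exact: (ltn_ord y).
by exists (Ordinal x_d) => //; apply: val_inj.
Qed.

Lemma extremal_indeg (x : extremal) : indeg x = outdeg x.
Proof. by apply: eq_card => y; rewrite !inE /= extremal_arc_sym. Qed.

Lemma extremal_outdeg (x : extremal) : d < n ->
  outdeg x = if x < d then n.-1 else d.
Proof.
move=> d_n; rewrite /outdeg; case: ifP => x_d.
  rewrite -[n in RHS]card_ord -(cardC1 x); apply: eq_card => y.
  by rewrite !inE /= /extremal_arc x_d andbT eq_sym.
rewrite -[RHS](card_lt (ltnW d_n)).
apply: eq_card => y; rewrite !inE /= /extremal_arc x_d /=.
case: eqVneq => // <-; by rewrite x_d.
Qed.

End Extremal.

Lemma min_semidegree_le (D : digraph) (v : D) :
  min_semidegree D <= outdeg v /\ min_semidegree D <= indeg v.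
Proof.
suff : min_semidegree D <= minn (outdeg v) (indeg v) by rewrite leq_min => /andP.
rewrite /min_semidegree; have: v \in index_enum D by rewrite mem_index_enum.
elim: (index_enum D) => //= u r IHr; rewrite inE big_cons geq_min.
by case/predU1P=> [<-|/IHr ->]; rewrite ?leqnn ?orbT.
Qed.

Lemma extremal_min_semidegree n d : d < n -> min_semidegree (extremal n d) = d.
Proof.
move=> d_n; apply/eqP; rewrite eqn_leq; apply/andP; split.
  have [+ _] := @min_semidegree_le (extremal n d) (Ordinal d_n : 'I_n).
  by rewrite extremal_outdeg //= ltnn.
rewrite /min_semidegree; elim/big_ind: _ => [|x y|v _].
- by rewrite /dorder card_ord ltnW.
- by rewrite leq_min => -> ->.
rewrite leq_min extremal_indeg extremal_outdeg // andbb.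
by case: ifP => // _; lia.
Qed.

Lemma extremal_not_coverable n d k : 2 * k <= d -> d < n -> 2 * d < n + k ->
  ~ unpaired_coverable (extremal n d) k.
Proof.
move=> k_d d_n dnk [_ cov].
have s_d (i : 'I_k) : i < d by have:= ltn_ord i; lia.
have t_d (i : 'I_k) : k + i < d by have:= ltn_ord i; lia.
have s_lt i := ltn_trans (s_d i) d_n; have t_lt i := ltn_trans (t_d i) d_n.
pose s i : extremal n d := Ordinal (s_lt i).
pose t i : extremal n d := Ordinal (t_lt i).
have [|||P DP] := cov s t.
- by move=> i j [] /val_inj.
- by move=> i j [] /addnI/val_inj.
- by move=> i j; apply/eqP => -[] E; have:= ltn_ord i; rewrite E ltnNge leq_addr.
pose I : pred (extremal n d) := fun v : 'I_n => d <= v.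
have bound : #|I| + k <= #|predC I|.
  apply: (DDPC_independent _ _ _ DP) => [u v du dv|i|i].
  - by rewrite /= /extremal_arc negb_and !ltnNge [d <= u]du [d <= v]dv orbT.
  - by rewrite /I /= -ltnNge.
  - by rewrite /I /= -ltnNge.
have cardNI : #|predC I| = d.
  rewrite -[RHS](card_lt (ltnW d_n)); apply: eq_card => v.
  by rewrite !inE /I /= -ltnNge.
move: bound (cardC I); rewrite cardNI card_ord; move: #|I| => m; clear -dnk; lia.
Qed.

Theorem theorem1 (k : nat) (k_gt0 : 0 < k) :
  (forall D : digraph,
     3 * k <= dorder D ->
     uphalf (dorder D + k) <= min_semidegree D ->
     unpaired_coverable D k)
  /\
  (forall n : nat,
     3 * k + 1 <= n ->
     exists D : digraph,
       [/\ dorder D = n,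
           min_semidegree D = uphalf (n + k) - 1
         & ~ unpaired_coverable D k]).
Proof.
split=> [D n_ge deg_ge|n n_ge].
  split=> [|s t s_inj t_inj st_disj]; first by lia.
  have semi_ge (v : D) : #|D| + k <= 2 * outdeg v /\ #|D| + k <= 2 * indeg v.
    have [out_ge in_ge] := min_semidegree_le v.
    rewrite -/(dorder D); lia.
  apply: coverable_of_semidegree => //.
  - by move=> v; have [] := semi_ge v.
  - by move=> v; have [] := semi_ge v.
exists (extremal n (uphalf (n + k) - 1)); split.
- by rewrite /dorder card_ord.
- by apply: extremal_min_semidegree; lia.
- by apply: extremal_not_coverable; lia.
Qed.
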